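(* Let $C,R,L,U>0$ be real numbers with $C<R+L$, and let $\mathcal{G}_2$ be the two-player Checker–Asserter game with these parameters. Then $\mathcal{G}_2$ has no pure strategy Nash equilibrium; moreover, every Nash equilibrium of $\mathcal{G}_2$ is totally mixed, i.e. each player plays each of its two actions with strictly positive probability.
   Context: The game $\mathcal{G}_2$ is a one-shot simultaneous-move bimatrix game between a Checker (row player) with actions ''check'' and ''don't check'', and an Asserter (column player) with actions ''false'' and ''true'' (making a false or a true claim). The parameters are: $C$, the cost of checking; $R$, the Asserter's deposit (which is also the Checker's reward if a false claim is discovered); $L$, the Checker's loss if a false claim goes undetected; $U$, the Asserter's gain if a false claim goes undetected. The payoffs (Checker's payoff, Asserter's payoff) are: - (check, false): $(R-C,\,-R)$; - (check, true): $(-C,\,0)$; - (don't check, false): $(-L,\,U)$; - (don't check, true): $(0,\,0)$. Mixed strategies are allowed, and payoffs are extended to mixed strategies by expectation. *)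

(* Defs.v *)
From HB Require Import structures.
From mathcomp Require Import all_boot all_order all_algebra.
From mathcomp Require Import reals.

Set Implicit Arguments.
Unset Strict Implicit.
Unset Printing Implicit Defensive.

Import Order.TTheory GRing.Theory Num.Theory.
Local Open Scope ring_scope.

Record bimatrix_game (K : realType) (A B : finType) := BimatrixGame {
  row_payoff : A -> B -> K;
  col_payoff : A -> B -> K
}.

Definition is_mixed (K : realType) (A : finType) (s : A -> K) : Prop :=
  (forall a, 0 <= s a) /\ \sum_(a : A) s a = 1.

Definition totally_mixed (K : realType) (A : finType) (s : A -> K) : Prop :=
  forall a, 0 < s a.

(* The two players randomize independently. *)
Definition expected_payoff (K : realType) (A B : finType) (u : A -> B -> K)
    (s : A -> K) (t : B -> K) : K :=
  \sum_(a : A) \sum_(b : B) s a * t b * u a b.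

Definition pure_nash_equilibrium (K : realType) (A B : finType)
    (G : bimatrix_game K A B) (a : A) (b : B) : Prop :=
  (forall a', row_payoff G a' b <= row_payoff G a b) /\
  (forall b', col_payoff G a b' <= col_payoff G a b).

Definition nash_equilibrium (K : realType) (A B : finType)
    (G : bimatrix_game K A B) (s : A -> K) (t : B -> K) : Prop :=
  [/\ is_mixed s,
      is_mixed t,
      forall s', is_mixed s' ->
        expected_payoff (row_payoff G) s' t
          <= expected_payoff (row_payoff G) s t
    & forall t', is_mixed t' ->
        expected_payoff (col_payoff G) s t'
          <= expected_payoff (col_payoff G) s t].

Inductive checker_action := check | dont_check.

Inductive asserter_action := claim_false | claim_true.

Definition bool_of_checker_action (a : checker_action) : bool :=
  if a is check then true else false.
Definition checker_action_of_bool (b : bool) : checker_action :=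
  if b then check else dont_check.
Lemma bool_of_checker_actionK :
  cancel bool_of_checker_action checker_action_of_bool.
Proof. by case. Qed.
HB.instance Definition _ := Finite.copy checker_action
  (can_type bool_of_checker_actionK).

Definition bool_of_asserter_action (b : asserter_action) : bool :=
  if b is claim_true then true else false.
Definition asserter_action_of_bool (b : bool) : asserter_action :=
  if b then claim_true else claim_false.
Lemma bool_of_asserter_actionK :
  cancel bool_of_asserter_action asserter_action_of_bool.
Proof. by case. Qed.
HB.instance Definition _ := Finite.copy asserter_action
  (can_type bool_of_asserter_actionK).

Definition checker_payoff (K : realType) (C R L : K)
    (a : checker_action) (b : asserter_action) : K :=
  match a, b with
  | check, claim_false => R - C
  | check, claim_true => - C
  | dont_check, claim_false => - L
  | dont_check, claim_true => 0
  end.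

Definition asserter_payoff (K : realType) (R U : K)
    (a : checker_action) (b : asserter_action) : K :=
  match a, b with
  | check, claim_false => - R
  | check, claim_true => 0
  | dont_check, claim_false => U
  | dont_check, claim_true => 0
  end.

(* [C]: cost of checking; [R]: the Asserter's deposit, which the Checker
   receives on discovering a false claim; [L] and [U]: the Checker's loss and
   the Asserter's gain when a false claim goes undetected. *)
Definition game_G2 (K : realType) (C R L U : K) :
    bimatrix_game K checker_action asserter_action :=
  BimatrixGame (checker_payoff C R L) (asserter_payoff R U).

(* Main.v *)
Require Import Defs.
From mathcomp Require Import all_boot all_order all_algebra.
From mathcomp Require Import reals.
From mathcomp Require Import lra.

Import Order.TTheory GRing.Theory Num.Theory.
Local Open Scope ring_scope.

(** A Nash equilibrium cannot be improved by a deviation to a pure strategy.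
    With [p] the probability of checking and [q] that of a false claim, these
    deviations give
      [(1 - p) (q (R + L) - C) <= 0 <= p (q (R + L) - C)],
      [(1 - q) (U - p (R + U)) <= 0 <= q (U - p (R + U))].
    Best replies thus run around the cycle
      [p = 0] => [q = 1] => [p = 1] => [q = 0] => [p = 0],
    so a probability equal to [0] or [1] would force both [p = 0] and
    [p = 1]. *)

Lemma sum_checker_action (V : nmodType) (F : checker_action -> V) :
  \sum_(a : checker_action) F a = F check + F dont_check.
Proof.
rewrite (reindex checker_action_of_bool) ?big_bool //.
by exists bool_of_checker_action => [[]|[]].
Qed.

(** [claim_true] comes first because it is the image of [true], the first term of [big_bool]. *)
Lemma sum_asserter_action (V : nmodType) (F : asserter_action -> V) :
  \sum_(b : asserter_action) F b = F claim_true + F claim_false.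
Proof.
rewrite (reindex asserter_action_of_bool) ?big_bool //.
by exists bool_of_asserter_action => [[]|[]].
Qed.

Definition pure_strategy (K : realType) (A : finType) (a a' : A) : K :=
  (a' == a)%:R.

Lemma sum_pure (K : realType) (A : finType) (a : A) (F : A -> K) :
  \sum_(a' : A) pure_strategy K A a a' * F a' = F a.
Proof.
rewrite (bigD1 a) //= big1 => [|a' /negPf na]; rewrite /pure_strategy.
  by rewrite eqxx mul1r addr0.
by rewrite na mul0r.
Qed.

Lemma is_mixed_pure (K : realType) (A : finType) (a : A) :
  is_mixed (pure_strategy K A a).
Proof.
split=> [a'|]; first exact: ler0n.
(* The total mass is the expectation of the constant 1 under the point mass at [a]. *)
rewrite -[RHS](sum_pure K A a (fun=> 1)).
by apply: eq_bigr => a' _; rewrite mulr1.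
Qed.

Lemma expected_payoff_purel (K : realType) (A B : finType) (u : A -> B -> K)
    (a : A) (t : B -> K) :
  expected_payoff u (pure_strategy K A a) t = \sum_(b : B) t b * u a b.
Proof.
rewrite -[RHS](sum_pure K A a (fun a' => \sum_b t b * u a' b)).
apply: eq_bigr => a' _; rewrite mulr_sumr.
by apply: eq_bigr => b _; rewrite mulrA.
Qed.

Lemma expected_payoff_purer (K : realType) (A B : finType) (u : A -> B -> K)
    (s : A -> K) (b : B) :
  expected_payoff u s (pure_strategy K B b) = \sum_(a : A) s a * u a b.
Proof.
apply: eq_bigr => a _; rewrite -(sum_pure K B b (fun b' => s a * u a b')).
by apply: eq_bigr => b' _; rewrite mulrA (mulrC (s a)).
Qed.

Lemma nash_pure_deviation (K : realType) (A B : finType)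
    (G : bimatrix_game K A B) (s : A -> K) (t : B -> K) :
  nash_equilibrium G s t ->
  (forall a, \sum_(b : B) t b * row_payoff G a b
               <= expected_payoff (row_payoff G) s t) /\
  (forall b, \sum_(a : A) s a * col_payoff G a b
               <= expected_payoff (col_payoff G) s t).
Proof.
case=> _ _ rowP colP; split=> [a|b].
- by rewrite -expected_payoff_purel; apply/rowP/is_mixed_pure.
- by rewrite -expected_payoff_purer; apply/colP/is_mixed_pure.
Qed.

(** At each profile one player gains by switching: the Asserter gains [R] at (check, false) and [U]
    at (don't check, true); the Checker gains [C] at (check, true) and [R + L - C] at (don't check,
    false). *)
Lemma G2_pure_nash_equilibriumN (K : realType) (C R L U : K)
    (a : checker_action) (b : asserter_action) :
  0 < C -> 0 < R -> 0 < U -> C < R + L ->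
  ~ pure_nash_equilibrium (game_G2 C R L U) a b.
Proof.
move=> hC hR hU hCRL [rowP colP].
have [/= r1 r2] := (rowP check, rowP dont_check).
have [/= c1 c2] := (colP claim_false, colP claim_true).
case: a b r1 r2 c1 c2 {rowP colP} => -[] /= *; lra.
Qed.

(** [q * (R + L) - C] is the Checker's advantage of checking over not checking, and
    [U - p * (R + U)] the Asserter's of a false claim over a true one. *)
Lemma G2_nash_deviations (K : realType) (C R L U : K)
    (s : checker_action -> K) (t : asserter_action -> K) :
  let p := s check in let q := t claim_false in
  nash_equilibrium (game_G2 C R L U) s t ->
  [/\ (1 - p) * (q * (R + L) - C) <= 0,
      0 <= p * (q * (R + L) - C),
      (1 - q) * (U - p * (R + U)) <= 0
    & 0 <= q * (U - p * (R + U))].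
Proof.
move=> p q ne; have [rowP colP] := nash_pure_deviation _ _ _ _ _ _ ne.
case: ne => -[_ s1] [_ t1] _ _.
have sE : s dont_check = 1 - p.
  by move: s1; rewrite sum_checker_action /p; lra.
have tE : t claim_true = 1 - q.
  by move: t1; rewrite sum_asserter_action /q; lra.
have [r1 r2] := (rowP check, rowP dont_check).
have [c1 c2] := (colP claim_false, colP claim_true).
move: r1 r2 c1 c2; rewrite /expected_payoff.
rewrite !(sum_checker_action, sum_asserter_action) /= sE tE -/p -/q.
(* Once expanded, each goal is one deviation inequality, linear in the monomials. *)
by move=> *; split; lra.
Qed.

Lemma cyclic_deviations_interior (K : realFieldType) (C R L U p q : K) :
  0 < C -> 0 < R -> 0 < U -> C < R + L ->
  0 <= p <= 1 -> 0 <= q <= 1 ->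
  (1 - p) * (q * (R + L) - C) <= 0 -> 0 <= p * (q * (R + L) - C) ->
  (1 - q) * (U - p * (R + U)) <= 0 -> 0 <= q * (U - p * (R + U)) ->
  0 < p < 1 /\ 0 < q < 1.
Proof.
move=> hC hR hU hCRL /andP[p0 p1] /andP[q0 q1] r1 r2 c1 c2.
have p_neq0 : p != 0.
  apply/eqP => pE; subst p.
  (* Here [c1] reads [(1 - q) * U <= 0]; then [r1] gives [R + L <= C]. The other cases likewise
     follow two arrows of the cycle, ending in [R <= 0], [C <= 0] and [U <= 0]. *)
  have qE : q = 1 by apply/eqP; rewrite eq_le q1 /=; nra.
  by subst q; lra.
have q_neq1 : q != 1.
  apply/eqP => qE; subst q.
  have pE : p = 1 by apply/eqP; rewrite eq_le p1 /=; nra.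
  by subst p; lra.
have p_neq1 : p != 1.
  apply/eqP => pE; subst p.
  have qE : q = 0 by apply/eqP; rewrite eq_le q0 andbT; nra.
  by subst q; lra.
have q_neq0 : q != 0.
  apply/eqP => qE; subst q.
  have pE : p = 0 by apply/eqP; rewrite eq_le p0 andbT; nra.
  by subst p; lra.
by rewrite !lt_neqAle p0 p1 q0 q1 p_neq1 q_neq1 ![0 == _]eq_sym p_neq0 q_neq0.
Qed.

Theorem mainTheorem1 (K : realType) (C R L U : K)
    (hC : 0 < C) (hR : 0 < R) (hL : 0 < L) (hU : 0 < U) (hCRL : C < R + L) :
  (~ exists (a : checker_action) (b : asserter_action),
       pure_nash_equilibrium (game_G2 C R L U) a b) /\
  (forall (s : checker_action -> K) (t : asserter_action -> K),
     nash_equilibrium (game_G2 C R L U) s t ->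
     totally_mixed s /\ totally_mixed t).
Proof.
split=> [[a [b]]|s t ne]; first exact: G2_pure_nash_equilibriumN.
have [r1 r2 c1 c2] := G2_nash_deviations _ _ _ _ _ _ _ ne.
case: ne => -[s0 s1] [t0 t1] _ _.
move: s1 t1; rewrite sum_checker_action sum_asserter_action => s1 t1.
have p01 : 0 <= s check <= 1 by move: (s0 check) (s0 dont_check); lra.
have q01 : 0 <= t claim_false <= 1.
  by move: (t0 claim_false) (t0 claim_true); lra.
have [/andP[p_gt0 p_lt1] /andP[q_gt0 q_lt1]] :=
  cyclic_deviations_interior _ _ _ _ _ _ _ hC hR hU hCRL p01 q01 r1 r2 c1 c2.
(* The two remaining weights are the complements [1 - p] and [1 - q]. *)
by split=> -[] //; lra.
Qed.
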